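(* Let $\mathcal{D}$ be a quasi-symmetric $2$-$(v,k,\lambda)$ design with replication number $r$, $b$ blocks and two block intersection sizes $x\neq y$ (with no assumption on which is larger), and let $\Gamma_2$ be its block graph in which two blocks are adjacent if they intersect in $y$ points, a strongly regular graph with parameters $(b,a,c,d)$. Let $\Gamma$ be the graph whose vertex set is the disjoint union of the set $V_1$ of points and the set $V_2$ of blocks of $\mathcal{D}$, where any two distinct points are adjacent (the induced subgraph on $V_1$ is complete), a point is adjacent to a block if and only if they are incident, and the induced subgraph on $V_2$ is $\Gamma_2$. Suppose that $\Gamma$ is biregular with valency partition $(V_1,V_2)$. Let $\theta_1,\theta_2$ be real numbers. Then $\Gamma$ has three distinct $\mathcal{L}$-eigenvalues $0,\theta_1,\theta_2$ if and only if $$\begin{array}{rcl} \frac{v-1}{v-1+r}+\frac{r}{k+a}&=&t(v-1+r)^2-(\theta_1-1)(\theta_2-1)(v-1+r),\\ \frac{v-2}{v-1+r}+\frac{\lambda}{k+a}&=&t(v-1+r)^2+2-\theta_1-\theta_2,\\ \frac k{v-1+r}+\frac{a}{k+a}&=&t(k+a)^2-(\theta_1-1)(\theta_2-1)(k+a),\\ \frac{x}{v-1+r}+\frac{d}{k+a}&=&t(k+a)^2,\\ \frac{y}{v-1+r}+\frac{c}{k+a}&=&t(k+a)^2+2-\theta_1-\theta_2,\\ \frac{k}{v-1+r}+\frac{\lambda k-xr}{(y-x)(k+a)}&=&t(v-1+r)(k+a),\\ \frac{k-1}{v-1+r}+\frac{(\lambda-1)(k-1)-(x-1)(r-1)}{(y-x)(k+a)}&=&t(v-1+r)(k+a)+2-\theta_1-\theta_2,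 \end{array}$$ where $t=\frac{\theta_1\theta_2}{v(v-1+r)+b(k+a)}$.
   Context: All graphs are finite, simple and undirected. $d_u$ denotes the valency (degree) of vertex $u$. The normalized Laplacian of a graph is the matrix $\mathcal{L}=[\ell_{uv}]$ indexed by the vertices with $\ell_{uu}=1$ if $d_u\neq 0$, $\ell_{uv}=-1/\sqrt{d_ud_v}$ if $u$ and $v$ are adjacent, and $\ell_{uv}=0$ otherwise. Its eigenvalues are called the $\mathcal{L}$-eigenvalues of the graph. A graph is biregular if exactly two distinct valencies occur; the valency partition is the partition of the vertex set according to valencies. A $2$-$(v,k,\lambda)$ design ($2\le k<v$, $\lambda\ge1$) has $v$ points and a collection of $b$ blocks (repeated blocks allowed), each block incident with $k$ points, such that any two distinct points are in exactly $\lambda$ common blocks; each point is then in $r=\lambda\frac{v-1}{k-1}$ blocks and $b=\frac{vr}{k}$. It is quasi-symmetric with block intersection sizes $x\neq y$ if any two distinct blocks meet in $x$ or $y$ points, both sizes occurring. A graph is strongly regular with parameters $(n,k',\lambda',\mu')$ if it has $n$ vertices, is $k'$-regular with $0<k'<n-1$, and any two distinct vertices have $\lambda'$ common neighbors if adjacent and $\mu'$ otherwise. The block graph $\Gamma_2$ of a quasi-symmetric design (blocks adjacent when they meet in $y$ points) is strongly regular with parameters $(b,a,c,d)$, where $a=\frac{(r-1)k-x(b-1)}{y-x}$, $d=a+\rho_1\rho_2$, $c=d+\rho_1+\rho_2$, with $\rho_1=\frac{r-\lambda-k+x}{y-x}$ and $\rho_2=\frac{x-k}{y-x}$. For a point-block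 pair $(P,B)$, the number of blocks $B'\neq B$ incident with $P$ and meeting $B$ in $y$ points equals $\frac{(\lambda-1)(k-1)-(x-1)(r-1)}{y-x}$ if $P$ is incident with $B$, and $\frac{\lambda k-xr}{y-x}$ otherwise. *)

(* Defs.v *)
From mathcomp Require Import all_boot all_order all_algebra.
From mathcomp Require Import reals.
From mathcomp Require Import ring lra.

Set Implicit Arguments.
Unset Strict Implicit.
Unset Printing Implicit Defensive.

Import Order.TTheory GRing.Theory Num.Theory.
Local Open Scope ring_scope.

Section Graphs.
Variables (T : finType) (e : rel T).

Definition simple_graph : Prop := symmetric e /\ irreflexive e.

Definition valency (u : T) : nat := #|[set w | e u w]|.

Definition common_neighbors (u w : T) : nat := #|[set z | e u z && e w z]|.

Definition biregular : Prop := size (undup [seq valency u | u : T]) = 2%N.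

Definition valency_partition : {set {set T}} :=
  preim_partition valency [set: T].

Definition strongly_regular (n k l m : nat) : Prop :=
  [/\ simple_graph, #|T| = n, (0 < k < n.-1)%N,
      forall u, valency u = k
    & forall u w, u != w -> common_neighbors u w = if e u w then l else m].

Variable R : realType.

(* Rows and columns are indexed by the vertices through enum_val. *)
Definition normalized_laplacian : 'M[R]_#|T| :=
  \matrix_(i, j)
    let u := enum_val i in
    let w := enum_val j in
    if u == w then (valency u != 0)%N%:R
    else if e u w then - (Num.sqrt ((valency u)%:R * (valency w)%:R))^-1
    else 0.

Definition L_eigenvalue (a : R) : bool := eigenvalue normalized_laplacian a.

(* The three listed values are pairwise distinct, and they are exactly the
   eigenvalues (each of any multiplicity). *)
Definition three_distinct_L_eigenvalues (t0 t1 t2 : R) : Prop :=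
  uniq [:: t0; t1; t2] /\ forall a, L_eigenvalue a = (a \in [:: t0; t1; t2]).

End Graphs.

Section Designs.
(* Blocks form an abstract type, so distinct blocks may carry the same points,
   that is, repeated blocks are allowed. *)
Variables (P B : finType) (inc : P -> B -> bool).

Definition block_points (bl : B) : {set P} := [set p | inc p bl].

Definition point_blocks (p : P) : {set B} := [set bl | inc p bl].

Definition meet_size (bl bl' : B) : nat :=
  #|block_points bl :&: block_points bl'|.

Definition is_2design (v k lam : nat) : Prop :=
  [/\ (2 <= k < v)%N, (1 <= lam)%N, #|P| = v,
      forall bl, #|block_points bl| = k
    & forall p q, p != q -> #|point_blocks p :&: point_blocks q| = lam].

Definition replication_number (r : nat) : Prop :=
  forall p, #|point_blocks p| = r.

Definition quasi_symmetric (x y : nat) : Prop :=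
  [/\ x != y,
      forall bl bl', bl != bl' -> meet_size bl bl' = x \/ meet_size bl bl' = y,
      exists bl bl', bl != bl' /\ meet_size bl bl' = x
    & exists bl bl', bl != bl' /\ meet_size bl bl' = y].

Definition block_graph (y : nat) : rel B :=
  fun bl bl' => (bl != bl') && (meet_size bl bl' == y).

Definition point_block_graph (y : nat) : rel (P + B) :=
  fun u w =>
    match u, w with
    | inl p, inl q => p != q
    | inl p, inr bl => inc p bl
    | inr bl, inl p => inc p bl
    | inr bl, inr bl' => block_graph y bl bl'
    end.

Definition point_vertices : {set P + B} := [set inl p | p : P].

Definition block_vertices : {set P + B} := [set inr bl | bl : B].

Lemma block_graph_simple y : simple_graph (block_graph y).
Proof.
split=> [bl bl'|bl]; rewrite /block_graph ?eqxx //.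
by rewrite eq_sym /meet_size setIC.
Qed.

Lemma point_block_graph_simple y : simple_graph (point_block_graph y).
Proof.
have [sym irr] := block_graph_simple y.
by split=> [[p|bl] [q|bl']|[p|bl]] //=; rewrite ?eqxx // eq_sym.
Qed.

End Designs.

(* Parameters (b, a, c, d) of the block graph of a quasi-symmetric design; that
   they are its strongly regular parameters is block_graph_strongly_regular. *)
Section BlockGraphParameters.
Variables (R : fieldType) (b k r lam x y : nat).

Definition bg_a : R :=
  ((r%:R - 1) * k%:R - x%:R * (b%:R - 1)) / (y%:R - x%:R).

Definition bg_rho1 : R := (r%:R - lam%:R - k%:R + x%:R) / (y%:R - x%:R).

Definition bg_rho2 : R := (x%:R - k%:R) / (y%:R - x%:R).

Definition bg_d : R := bg_a + bg_rho1 * bg_rho2.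

Definition bg_c : R := bg_d + bg_rho1 + bg_rho2.

End BlockGraphParameters.

Section BlockGraphStronglyRegular.
Variables (R : realType) (P B : finType) (inc : P -> B -> bool).
Variables (v k lam r x y : nat).
Hypotheses (des : is_2design inc v k lam) (rep : replication_number inc r).
Hypothesis qs : quasi_symmetric inc x y.

Let A (bl bl' : B) : R := (block_graph inc y bl bl')%:R.
Let N (p : P) (bl : B) : R := (inc p bl)%:R.
Let M (bl bl' : B) : R := (meet_size inc bl bl')%:R.

Let sum_bool (T : finType) (f : pred T) :
  \sum_i ((f i)%:R : R) = #|[set i | f i]|%:R.
Proof.
rewrite -sum1_card natr_sum [RHS]big_mkcond /=; apply: eq_bigr => i _.
by rewrite inE; case: (f i).
Qed.

Let yx_neq0 : y%:R - x%:R != 0 :> R.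
Proof. by case: qs => xy _ _ _; rewrite subr_eq0 eqr_nat eq_sym. Qed.

Let MN bl bl' : M bl bl' = \sum_p N p bl * N p bl'.
Proof.
rewrite /M /meet_size (_ : _ :&: _ = [set p | inc p bl && inc p bl']).
  by rewrite -sum_bool; apply: eq_bigr => p _; rewrite /N -natrM mulnb.
by apply/setP => p; rewrite !inE.
Qed.

Let NN p q : \sum_bl N p bl * N q bl = (r%:R - lam%:R) * (p == q)%:R + lam%:R.
Proof.
have -> : \sum_bl N p bl * N q bl =
          #|point_blocks inc p :&: point_blocks inc q|%:R.
  rewrite (_ : _ :&: _ = [set bl | inc p bl && inc q bl]).
    by rewrite -sum_bool; apply: eq_bigr => bl _; rewrite /N -natrM mulnb.
  by apply/setP => bl; rewrite !inE.
case: eqVneq => [->|pq]; last first.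
  by case: des => _ _ _ _ ->; rewrite //= mulr0 add0r.
by rewrite setIid rep /= mulr1 subrK.
Qed.

Let sumN bl : \sum_p N p bl = k%:R.
Proof. by rewrite /N sum_bool; case: des => _ _ _ /(_ bl) <- _. Qed.

Let sumA bl : \sum_bl' A bl bl' = (valency (block_graph inc y) bl)%:R.
Proof. by rewrite sum_bool. Qed.

Let ME bl bl' : M bl bl' =
  (k%:R - x%:R) * (bl == bl')%:R + x%:R + (y%:R - x%:R) * A bl bl'.
Proof.
rewrite /M /A /block_graph; case: eqVneq => [<-|nbl] /=.
  by rewrite /meet_size setIid; case: des => _ _ _ -> _ /=; ring.
case: qs => xy /(_ _ _ nbl) [] -> _ _; last first.
  by rewrite eqxx /=; ring.
by rewrite (negPf xy) /=; ring.
Qed.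

Let sum_eq (bl : B) (F : B -> R) : \sum_c (bl == c)%:R * F c = F bl.
Proof.
rewrite (bigD1 bl) //= eqxx mul1r big1 ?addr0 // => c.
by rewrite eq_sym => /negPf ->; rewrite mul0r.
Qed.

Let sum_delta (bl : B) : \sum_c (bl == c)%:R = 1 :> R.
Proof. by rewrite -[RHS](sum_eq bl (fun=> 1)); apply: eq_bigr => c; rewrite mulr1. Qed.

Let deltaC (T : eqType) (a c : T) : (a == c)%:R = (c == a)%:R :> R.
Proof. by rewrite eq_sym. Qed.

Let AC bl bl' : A bl bl' = A bl' bl.
Proof. by rewrite /A; case: (block_graph_simple inc y) => ->. Qed.

Let sumM bl : \sum_c M bl c = r%:R * k%:R.
Proof.
under eq_bigr do rewrite MN; rewrite exchange_big /=.
under eq_bigr do rewrite -mulr_sumr /N sum_bool.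
rewrite -[in RHS](sumN bl) mulr_sumr; apply: eq_bigr => p _.
by rewrite mulrC; congr (_ * _); rewrite -(rep p).
Qed.

Let valencyE bl :
  (valency (block_graph inc y) bl)%:R = bg_a R #|B| k r x y.
Proof.
have := sumM bl; under eq_bigr do rewrite ME.
rewrite !big_split /= -!mulr_sumr sumA.
rewrite sum_delta sumr_const -[_ *+ _]mulr_natr => E.
apply: (mulIf yx_neq0); rewrite /bg_a mulfVK //.
by rewrite [LHS]mulrC; move: E; set u := _ * (valency _ _)%:R => E; lra.
Qed.

Let MM bl bl' : \sum_c M bl c * M c bl' =
  (r%:R - lam%:R) * M bl bl' + lam%:R * k%:R ^+ 2.
Proof.
have -> : \sum_c M bl c * M c bl' =
   \sum_p \sum_q N p bl * N q bl' * \sum_c N p c * N q c.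
  under eq_bigr => c _.
    rewrite !MN mulr_suml; under eq_bigr do rewrite mulr_sumr; over.
  rewrite exchange_big /=; apply: eq_bigr => p _.
  rewrite exchange_big /=; apply: eq_bigr => q _.
  by rewrite mulr_sumr; apply: eq_bigr => c _; ring.
under eq_bigr => p _.
  rewrite (_ : \sum_q _ =
    N p bl * ((r%:R - lam%:R) * N p bl' + lam%:R * k%:R)); last first.
    transitivity (N p bl * ((r%:R - lam%:R) * (\sum_q (p == q)%:R * N q bl')
                            + lam%:R * \sum_q N q bl')).
      rewrite mulr_sumr mulr_sumr -big_split /= mulr_sumr.
      by apply: eq_bigr => q _; rewrite NN; ring.
    rewrite sumN; congr (_ * (_ * _ + _)).
    rewrite (bigD1 p) //= eqxx mul1r big1 ?addr0 // => q.
    by rewrite eq_sym => /negPf ->; rewrite mul0r.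
  over.
rewrite (eq_bigr (fun p => (r%:R - lam%:R) * (N p bl * N p bl')
    + lam%:R * k%:R * N p bl)); last by move=> p _; ring.
by rewrite big_split /= -!mulr_sumr -MN sumN; ring.
Qed.

Let sumAA bl bl' : \sum_c A bl c * A c bl' =
  (common_neighbors (block_graph inc y) bl bl')%:R.
Proof.
rewrite /common_neighbors -sum_bool; apply: eq_bigr => c _.
by rewrite [A c bl']AC /A -natrM mulnb.
Qed.

Let MM2 bl bl' (a := bg_a R #|B| k r x y) : \sum_c M bl c * M c bl' =
  (k%:R - x%:R) ^+ 2 * (bl == bl')%:R + x%:R ^+ 2 * #|B|%:R
  + 2 * (k%:R - x%:R) * x%:R + 2 * (k%:R - x%:R) * (y%:R - x%:R) * A bl bl'
  + 2 * x%:R * (y%:R - x%:R) * a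
  + (y%:R - x%:R) ^+ 2 * (common_neighbors (block_graph inc y) bl bl')%:R.
Proof.
transitivity ((k%:R - x%:R) * (\sum_c (bl == c)%:R * M c bl')
  + x%:R * (\sum_c M bl' c)
  + (y%:R - x%:R) * (\sum_c (k%:R - x%:R) * ((bl' == c)%:R * A bl c)
      + \sum_c x%:R * A bl c + \sum_c (y%:R - x%:R) * (A bl c * A c bl'))).
  rewrite -!big_split /= !mulr_sumr -!big_split /=; apply: eq_bigr => c _.
  rewrite (ME bl c) (_ : M bl' c = M c bl'); last by rewrite /M /meet_size setIC.
  by rewrite (ME c bl') (deltaC c bl'); ring.
rewrite sum_eq -!mulr_sumr sum_eq sumA valencyE sumAA ME -/a.
under eq_bigr do rewrite ME.
rewrite !big_split /= -!mulr_sumr sumA valencyE -/a.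
by rewrite sum_delta sumr_const -[_ *+ _]mulr_natr; ring.
Qed.

Let commonE bl bl' : bl != bl' ->
  (common_neighbors (block_graph inc y) bl bl')%:R =
  if block_graph inc y bl bl' then bg_c R #|B| k r lam x y
  else bg_d R #|B| k r lam x y.
Proof.
move=> nbl.
have D : (y%:R - x%:R) ^+ 2 * (bg_a R #|B| k r x y) =
    (r%:R - lam%:R) * k%:R + lam%:R * k%:R ^+ 2 - (k%:R - x%:R) ^+ 2
    - x%:R ^+ 2 * #|B|%:R - 2 * (k%:R - x%:R) * x%:R
    - 2 * x%:R * (y%:R - x%:R) * bg_a R #|B| k r x y.
  have := MM bl bl; rewrite MM2 ME eqxx.
  have -> : A bl bl = 0 by rewrite /A /block_graph eqxx.
  suff -> : common_neighbors (block_graph inc y) bl bl =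
            valency (block_graph inc y) bl.
    by rewrite valencyE /= => E; lra.
  by rewrite /common_neighbors /valency; apply: eq_card => z; rewrite !inE andbb.
have := MM bl bl'; rewrite MM2 ME (negPf nbl) /A => E.
have z2 : (y%:R - x%:R) ^+ 2 != 0 :> R by rewrite expf_neq0.
have Ed : (y%:R - x%:R) ^+ 2 * bg_d R #|B| k r lam x y =
    (y%:R - x%:R) ^+ 2 * bg_a R #|B| k r x y
    + (r%:R - lam%:R - k%:R + x%:R) * (x%:R - k%:R).
  by rewrite /bg_d /bg_rho1 /bg_rho2; field.
have Ec : (y%:R - x%:R) ^+ 2 * bg_c R #|B| k r lam x y =
    (y%:R - x%:R) ^+ 2 * bg_d R #|B| k r lam x y
    + (y%:R - x%:R) * (r%:R - lam%:R - k%:R + x%:R + x%:R - k%:R).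
  by rewrite /bg_c /bg_rho1 /bg_rho2; field.
apply: (mulfI z2); case: ifP E => /= _ E; rewrite ?Ec Ed D; lra.
Qed.

Lemma block_graph_strongly_regular : exists a c d : nat,
  [/\ strongly_regular (block_graph inc y) #|B| a c d,
      a%:R = bg_a R #|B| k r x y, c%:R = bg_c R #|B| k r lam x y
    & d%:R = bg_d R #|B| k r lam x y].
Proof.
have [xy dich [b1 [b2 [n12 m12]]] [b3 [b4 [n34 m34]]]] := qs.
have a12 : block_graph inc y b1 b2 = false.
  by rewrite /block_graph m12 (negPf xy) andbF.
have a34 : block_graph inc y b3 b4 by rewrite /block_graph n34 m34 eqxx.
have Ea bl : valency (block_graph inc y) bl = valency (block_graph inc y) b3.
  by apply/eqP; rewrite -(eqr_nat R) !valencyE.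
exists (valency (block_graph inc y) b3).
exists (common_neighbors (block_graph inc y) b3 b4).
exists (common_neighbors (block_graph inc y) b1 b2).
split; first last.
- by rewrite commonE // a12.
- by rewrite commonE // a34.
- exact: valencyE.
split=> //; first exact: block_graph_simple.
  apply/andP; split; first by apply/card_gt0P; exists b4; rewrite inE.
  rewrite -(Ea b1); have -> : #|B|.-1 = #|[set~ b1]|.
    by rewrite cardsC1.
  apply: proper_card; apply/properP; split.
    by apply/subsetP => z; rewrite !inE /block_graph eq_sym => /andP[].
  by exists b2; rewrite !inE ?a12 // eq_sym.
move=> u w uw; apply/eqP; rewrite -(eqr_nat R) commonE //.
by case: ifP => _; rewrite commonE // ?a12 ?a34.
Qed.

End BlockGraphStronglyRegular.

(* Main.v *)
(* Let [D] be the diagonal matrix of the valencies, [A] the adjacency matrix, and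
   [w] the vector of the square roots of the valencies. As [Gamma] is connected,
   [w] spans the kernel of the symmetric matrix [L]. Since [L] is diagonalizable,
   its eigenvalues lie in [{0, theta1, theta2}] iff [(L - theta1)(L - theta2)]
   vanishes on the orthogonal complement of [w], i.e. iff it equals
   [theta1 theta2 / |w|^2] times [w w^T]. Scaling rows and columns by the square
   roots of the valencies turns this into
     A D^-1 A = t (D 1) (D 1)^T + (2 - theta1 - theta2) A
                - (theta1 - 1) (theta2 - 1) D,
   whose entries are the seven equations, one for each kind of pair of vertices.
   No two-element list contains the spectrum, since [L^2 = s L] fails at two
   non-adjacent vertices with a common neighbour; so all three values are
   distinct eigenvalues. *)
Require Import Defs.
From mathcomp Require Import all_boot all_order all_algebra.
From mathcomp Require Import reals.
From mathcomp Require Import ring lra zify spectral sesquilinear complex.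

Import Order.TTheory GRing.Theory Num.Theory.
Local Open Scope ring_scope.

Set Implicit Arguments.
Unset Strict Implicit.
Unset Printing Implicit Defensive.

(** * Spectra of real symmetric matrices *)

(** Over [R[i]] the matrix is Hermitian, hence unitarily diagonalizable with real diagonal entries.
    Each entry is an eigenvalue of [L], so it lies in [s] and annihilates one factor of the
    product. *)
Lemma symmetric_prod_eigenvalues (R : rcfType) n (L : 'M[R]_n) (s : seq R) :
  L^T = L -> (forall a, eigenvalue L a -> a \in s) ->
  \big[mulmx/1%:M]_(c <- s) (L - c%:M) = 0.
Proof.
move=> symL eigL; pose f : {rmorphism R -> R[i]} := real_complex R.
pose LC := map_mx f L; pose P := spectralmx LC; pose D := spectral_diag LC.
have realLC : LC \is a mxOver Num.real.
  by apply/mxOverP => i j; rewrite mxE; apply/complex_realP; exists (L i j).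
have hermLC : LC \is hermitianmx _ false Num.conj.
  apply: realsym_hermsym => //; apply/is_hermitianmxP.
  by rewrite expr0 scale1r map_mx_id // /LC map_trmx symL.
have ELC : LC = invmx P *m diag_mx D *m P.
  by apply/orthomx_spectralP/hermitian_normalmx.
have unitP : P \in unitmx by apply: spectral_unit.
have PLC : P *m LC = diag_mx D *m P by rewrite ELC !mulmxA mulmxV // mul1mx.
have D_s j : exists2 c, c \in s & D 0 j = f c.
  have /complex_realP[c Dc] : D 0 j \is Num.real.
    by have /mxOverP := hermitian_spectral_diag_real hermLC; apply.
  exists c => //; apply: eigL; rewrite -(eigenvalue_map f).
  (* Since [P LC = D P], row [j] of [P] is a left eigenvector for [D 0 j]. It is nonzero, since
     otherwise expanding along it would give [\det P = 0]. *)
  apply/eigenvalueP; exists (row j P).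
    by rewrite -row_mul PLC row_mul row_diag_mx -scalemxAl -rowE Dc.
  apply: contraTneq unitP => Pj0; rewrite unitmxE unitfE negbK.
  rewrite (expand_det_row _ j) big1 // => k _.
  by move/rowP/(_ k): Pj0; rewrite !mxE => ->; rewrite mul0r.
(* Conjugation by [P] makes every factor diagonal, so the whole product becomes diagonal with
   entries multiplied pointwise. *)
have prodE r : P *m map_mx f (\big[mulmx/1%:M]_(c <- r) (L - c%:M)) =
    diag_mx (\row_j \prod_(c <- r) (D 0 j - f c)) *m P.
  elim: r => [|c r IH].
    rewrite big_nil map_mx1 mulmx1 -[LHS]mul1mx; congr (_ *m _).
    by apply/matrixP => i j; rewrite !mxE big_nil.
  rewrite big_cons map_mxM map_mxB map_scalar_mx mulmxA mulmxBr PLC.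
  rewrite scalar_mxC -mulmxBl -mulmxA IH mulmxA; congr (_ *m _).
  rewrite -diag_const_mx -raddfB mulmx_diag; congr diag_mx.
  by apply/rowP => j; rewrite !mxE big_cons.
apply/eqP; rewrite -(map_mx_eq0 f) -(mulKmx unitP (map_mx _ _)) prodE.
rewrite (_ : \row_j _ = 0) ?raddf0 ?mul0mx ?mulmx0 //; apply/rowP => j.
by have [c cs Dc] := D_s j; rewrite !mxE (big_rem c cs) /= Dc subrr mul0r.
Qed.

(** If the spectrum lies in the list, then [L N = 0], so each column of [N] is a multiple of [w];
    pairing with [w] determines the multiple, as [w^T N = theta1 theta2 w^T]. Conversely the
    rank-one form gives [L N = 0], which on an eigenvector reads
    [a (a - theta1) (a - theta2) = 0]. *)
Lemma eigenvalues_in_three_roots (R : rcfType) n (L : 'M[R]_n) (w : 'cV[R]_n)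
    (theta1 theta2 : R) :
  L^T = L -> w != 0 -> L *m w = 0 ->
  (forall f : 'cV_n, L *m f = 0 -> exists c, f = c *: w) ->
  (forall a, eigenvalue L a -> a \in [:: 0; theta1; theta2]) <->
  (L - theta1%:M) *m (L - theta2%:M)
    = (theta1 * theta2 / (\sum_i w i 0 ^+ 2)) *: (w *m w^T).
Proof.
move=> symL w0 Lw kerL; set N := _ *m _; set s := \sum_i _.
have s0 : s != 0.
  apply: contra w0; rewrite psumr_eq0 => [|i _]; last exact: sqr_ge0.
  move=> /allP w0; apply/eqP/colP => i; rewrite mxE; apply/eqP.
  by have := w0 i (mem_index_enum i); rewrite /= sqrf_eq0.
have NLE : L *m N = \big[mulmx/1%:M]_(c <- [:: 0; theta1; theta2]) (L - c%:M).
  by rewrite !big_cons big_nil mulmx1 raddf0 subr0.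
split=> [/(symmetric_prod_eigenvalues symL)|NE a /eigenvalueP[u uL u0]].
  rewrite -NLE => LN0.
  have colN j : exists c, col j N = c *: w.
    by apply: kerL; rewrite colE mulmxA LN0 mul0mx.
  have wN : w^T *m N = (theta1 * theta2) *: w^T.
    have wL : w^T *m L = 0 by rewrite -[in LHS]symL -trmx_mul Lw trmx0.
    have wB c : w^T *m (L - c%:M) = - c *: w^T.
      by rewrite mulmxBr wL sub0r mul_mx_scalar scaleNr.
    by rewrite mulmxA wB -scalemxAl wB scalerA mulrNN.
  apply/matrixP => i j; have [c Nj] := colN j.
  have wwE : (w^T *m w) 0 0 = s.
    by rewrite mxE; apply: eq_bigr => k _; rewrite mxE expr2.
  have cs : c * s = theta1 * theta2 * w j 0.
    have : c *: (w^T *m w) = (theta1 * theta2) *: col j w^T.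
      by rewrite scalemxAr -Nj colE mulmxA wN -scalemxAl -colE.
    by move/matrixP/(_ 0 0); rewrite [LHS]mxE wwE !mxE.
  have -> : N i j = c * w i 0.
    by have /colP/(_ i) := Nj; rewrite [LHS]mxE [RHS]mxE.
  rewrite !mxE big_ord1 !mxE.
  apply: (mulIf s0); rewrite mulrAC cs.
  by field.
have : u *m (L *m N) = 0.
  by rewrite NE -scalemxAr mulmxA Lw mul0mx scaler0 mulmx0.
have uB c : u *m (L - c%:M) = (a - c) *: u.
  by rewrite mulmxBr uL mul_mx_scalar scalerBl.
rewrite NLE 3!big_cons big_nil mulmx1 !mulmxA !(uB, =^~ scalemxAl).
move/eqP; rewrite !scaler_eq0 (negPf u0) orbF !inE !subr_eq0.
by rewrite orbA orbC => /or3P[] ->; rewrite ?orbT.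
Qed.

Lemma quadratic_of_eigenvalues_in_pair (R : rcfType) n (L : 'M[R]_n) (s : R) :
  L^T = L -> (forall a, eigenvalue L a -> a \in [:: 0; s]) ->
  L *m L = s *: L.
Proof.
move=> symL /(symmetric_prod_eigenvalues symL).
rewrite !big_cons big_nil mulmx1 raddf0 subr0 mulmxBr mul_mx_scalar.
by move/eqP; rewrite subr_eq0 => /eqP.
Qed.

(** If two of the three values coincide, or if [theta1] or [theta2] is not an eigenvalue, then the
    spectrum lies in some [{0, s}], which forces [L^2 = s L]. *)
Lemma eigenvalues_exactly_three (R : rcfType) n (L : 'M[R]_n)
    (theta1 theta2 : R) :
  L^T = L -> eigenvalue L 0 -> (forall s, L *m L != s *: L) ->
  (forall a, eigenvalue L a -> a \in [:: 0; theta1; theta2]) ->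
  uniq [:: 0; theta1; theta2] /\
  forall a, eigenvalue L a = (a \in [:: 0; theta1; theta2]).
Proof.
move=> symL eig0 notquad eigL.
have not_pair s : ~ forall a, eigenvalue L a -> a \in [:: 0; s].
  by move/(quadratic_of_eigenvalues_in_pair symL)/eqP; apply/negP.
have uniq3 : uniq [:: 0; theta1; theta2].
  rewrite /= !inE andbT negb_or -!andbA; apply/and3P; split; apply/eqP => E.
  - by apply: (not_pair theta2) => a /eigL; rewrite -E !inE; case: eqP.
  - by apply: (not_pair theta1) => a /eigL; rewrite -E !inE; do 2?case: eqP.
  - by apply: (not_pair theta2) => a /eigL; rewrite -E !inE; do 2?case: eqP.
split=> // a; apply/idP/idP => [/eigL //|]; rewrite !inE.
case/or3P => /eqP -> //; apply: contraT => neig.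
  case: (not_pair theta2) => a' eiga'; move: (eigL a' eiga'); rewrite !inE.
  case/or3P => /eqP E; rewrite E ?eqxx ?orbT //.
  by move: neig; rewrite -E eiga'.
case: (not_pair theta1) => a' eiga'; move: (eigL a' eiga'); rewrite !inE.
by case/or3P => /eqP E; rewrite E ?eqxx ?orbT //; move: neig; rewrite -E eiga'.
Qed.

(** * Sums over vertices and indicator functions *)

Lemma sum_enum_val (V : nmodType) (T : finType) (F : T -> V) :
  \sum_(i < #|T|) F (enum_val i) = \sum_z F z.
Proof. by rewrite -(big_enum_val (A := T) F). Qed.

Lemma sum_delta (R : pzSemiRingType) (T : finType) (u : T) (F : T -> R) :
  \sum_z (u == z)%:R * F z = F u.
Proof.
rewrite (bigD1 u) //= eqxx mul1r big1 ?addr0 // => z.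
by rewrite eq_sym => /negPf ->; rewrite mul0r.
Qed.

Lemma sum_bool_card (R : pzSemiRingType) (T : finType) (f : pred T) :
  \sum_z ((f z)%:R : R) = #|[set z | f z]|%:R.
Proof.
rewrite -sum1_card natr_sum [RHS]big_mkcond; apply: eq_bigr => z _.
by rewrite inE; case: (f z).
Qed.

(** * The normalized Laplacian of a connected graph *)

Section NormalizedLaplacian.
Variables (R : realType) (T : finType) (e : rel T).
Hypothesis e_simple : simple_graph e.
Hypothesis val_gt0 : forall u, (0 < valency e u)%N.

Let L := normalized_laplacian e R.
Let deg u : R := (valency e u)%:R.
Let q u : R := Num.sqrt (deg u).
(** The normalized adjacency matrix, with which [L = 1 - A]. *)
Let A u w : R := (e u w)%:R / (q u * q w).

Let deg_gt0 u : 0 < deg u. Proof. by rewrite ltr0n. Qed.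
Let q_gt0 u : 0 < q u. Proof. by rewrite sqrtr_gt0. Qed.
Let q_neq0 u : q u != 0. Proof. by rewrite gt_eqF. Qed.
Let q_sqr u : q u ^+ 2 = deg u. Proof. by rewrite sqr_sqrtr // ltW. Qed.

Let AC u w : A u w = A w u.
Proof. by rewrite /A e_simple.1 [q u * _]mulrC. Qed.

Let LE i j : L i j =
  (enum_val i == enum_val j)%:R - A (enum_val i) (enum_val j).
Proof.
rewrite mxE /A; case: eqVneq => [<-|_].
  by rewrite e_simple.2 mul0r subr0 -lt0n val_gt0.
by rewrite sub0r sqrtrM ?ler0n //; case: ifP; rewrite ?mul1r // mul0r oppr0.
Qed.

Lemma normalized_laplacian_tr : L^T = L.
Proof. by apply/matrixP => i j; rewrite mxE !LE eq_sym AC. Qed.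

Let shiftE (s1 s2 : R) i j (u := enum_val i) (w := enum_val j) :
  ((L - s1%:M) *m (L - s2%:M)) i j = (1 - s1) * (1 - s2) * (u == w)%:R
    - (2 - s1 - s2) * A u w + \sum_z A u z * A w z.
Proof.
have LsE s k l : (L - s%:M) k l =
    (1 - s) * (enum_val k == enum_val l)%:R - A (enum_val k) (enum_val l).
  rewrite [LHS]mxE LE !mxE -[k == l](inj_eq enum_val_inj).
  by case: eqP => _ /=; ring.
transitivity (\sum_z ((u == z)%:R *
      ((1 - s1) * (1 - s2) * (z == w)%:R - (1 - s1) * A z w)
    + ((w == z)%:R * (- (1 - s2) * A u z) + A u z * A w z))).
  rewrite mxE -[RHS]sum_enum_val; apply: eq_bigr => k _.
  by rewrite !LsE -/u -/w [w == _]eq_sym [A w _]AC; ring.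
by rewrite !big_split /= !sum_delta; ring.
Qed.

Let wvec : 'cV[R]_#|T| := \col_i q (enum_val i).

Let sum_wvec : \sum_i wvec i 0 ^+ 2 = \sum_u deg u.
Proof.
by rewrite -[RHS]sum_enum_val; apply: eq_bigr => i _; rewrite mxE q_sqr.
Qed.

Let sum_e u : \sum_z (e u z)%:R = deg u.
Proof. by rewrite sum_bool_card. Qed.

(** In terms of [g = f / q], the operator [L] is the combinatorial Laplacian divided by [q u]; the
    kernel of [L] thus corresponds to harmonic functions [g]. *)
Let mulL (f : 'cV[R]_#|T|) i (u := enum_val i) :
  (L *m f) i 0 = (\sum_z (e u z)%:R * 
     (f i 0 / q u - f (enum_rank z) 0 / q z)) / q u.
Proof.
transitivity (\sum_z ((u == z)%:R - A u z) * f (enum_rank z) 0).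
  rewrite mxE -[RHS]sum_enum_val; apply: eq_bigr => j _.
  by rewrite LE -/u enum_valK.
under eq_bigr do rewrite mulrBl; rewrite sumrB sum_delta enum_valK.
under [in RHS]eq_bigr do rewrite mulrBr; rewrite sumrB mulrBl.
rewrite -mulr_suml sum_e -q_sqr; congr (_ - _).
  by field; rewrite q_neq0.
rewrite mulr_suml; apply: eq_bigr => z _; rewrite /A.
by field; rewrite !q_neq0.
Qed.

Let L_wvec : L *m wvec = 0.
Proof.
apply/colP => i; rewrite mulL big1 ?mul0r ?mxE // => z _.
by rewrite !mxE enum_rankK !divff ?q_neq0 // subrr mulr0.
Qed.

Hypothesis e_connected : forall u w, connect e u w.

(** For harmonic [g] the Dirichlet form, the sum of [(g u - g z)^2] over adjacent pairs, vanishes.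
    So [g] is constant along edges, hence constant by connectedness. *)
Let ker_L (f : 'cV[R]_#|T|) : L *m f = 0 -> exists c, f = c *: wvec.
Proof.
move=> Lf; pose g u := f (enum_rank u) 0 / q u.
have harmonic u : \sum_z (e u z)%:R * (g u - g z) = 0.
  have /colP/(_ (enum_rank u)) := Lf; rewrite mulL enum_rankK mxE => /eqP.
  by rewrite mulf_eq0 invr_eq0 (negPf (q_neq0 u)) orbF => /eqP.
have dirichlet : \sum_u \sum_z (e u z)%:R * (g u - g z) ^+ 2 = 0.
  (* Each square splits as [g u (g u - g z) + g z (g z - g u)]; after exchanging the order of
     summation, both parts contain a harmonic sum. *)
  transitivity (\sum_u g u * (\sum_z (e u z)%:R * (g u - g z))
     + \sum_z g z * \sum_u (e z u)%:R * (g z - g u)); last first.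
    by rewrite !big1 ?addr0 // => u _; rewrite harmonic mulr0.
  under [X in _ + X]eq_bigr do rewrite mulr_sumr.
  rewrite [X in _ + X]exchange_big -big_split; apply: eq_bigr => u _ /=.
  rewrite mulr_sumr -big_split; apply: eq_bigr => z _ /=.
  by rewrite (e_simple.1 z u); ring.
have g_edge u z : e u z -> g u = g z.
  move=> euz; have nonneg u' z' : 0 <= (e u' z')%:R * (g u' - g z') ^+ 2 :> R.
    by rewrite mulr_ge0 ?ler0n ?sqr_ge0.
  have /eqP := dirichlet; rewrite psumr_eq0 => [|u' _]; last exact: sumr_ge0.
  move=> /allP/(_ u (mem_index_enum u)); rewrite /= psumr_eq0 //.
  move=> /allP/(_ z (mem_index_enum z)); rewrite /= euz mul1r sqrf_eq0 subr_eq0.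
  by move/eqP.
have g_const u z : g u = g z.
  have /connectP[p] := e_connected u z.
  elim: p u => [|u' p IH] u /=; first by move=> _ ->.
  by move=> /andP[/g_edge -> /IH]; apply.
(* With no vertices, any scalar serves. *)
have [u0 _|T0] := pickP (@predT T); last first.
  by exists 0; apply/colP => i; have := T0 (enum_val i).
exists (g u0); apply/colP => i; rewrite !mxE.
by rewrite (g_const _ (enum_val i)) /g enum_valK mulfVK.
Qed.

(** The rank-one criterion is read entrywise after multiplication by [q u * q w]. The path of length
    two with non-adjacent ends guarantees that two eigenvalues never suffice. *)
Lemma three_distinct_L_eigenvaluesP (theta1 theta2 : R)
    (t := theta1 * theta2 / \sum_u (valency e u)%:R) :
  (exists u w z, [/\ u != w, ~~ e u w, e u z & e w z]) ->
  three_distinct_L_eigenvalues e 0 theta1 theta2 <->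
  forall u w, \sum_z (e u z && e w z)%:R / (valency e z)%:R =
    t * (valency e u)%:R * (valency e w)%:R + (2 - theta1 - theta2) * (e u w)%:R
    - (theta1 - 1) * (theta2 - 1) * (valency e u)%:R * (u == w)%:R.
Proof.
move=> [u0 [w0 [z0 [u0w0 nadj u0z0 w0z0]]]].
have wvec0 : wvec != 0.
  apply/eqP => /colP/(_ (enum_rank u0)); rewrite !mxE => /eqP.
  by rewrite (negPf (q_neq0 _)).
have sum_A u w : \sum_z A u z * A w z =
    (\sum_z (e u z && e w z)%:R / deg z) / (q u * q w).
  rewrite mulr_suml; apply: eq_bigr => z _.
  rewrite /A -q_sqr -mulnb natrM; field; by rewrite !q_neq0.
have eig0 : eigenvalue L 0.
  apply/eigenvalueP; exists wvec^T; last by rewrite trmx_eq0.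
  by rewrite -normalized_laplacian_tr -trmx_mul L_wvec trmx0 scale0r.
(* At [(u0, w0)] the entry of [L] is zero, while that of [L^2] is a sum of nonnegative terms
   [A u0 z * A w0 z], positive at [z0]. *)
have notquad s : L *m L != s *: L.
  apply/eqP => /matrixP/(_ (enum_rank u0) (enum_rank w0)).
  have := shiftE 0 0 (enum_rank u0) (enum_rank w0).
  rewrite raddf0 subr0 !enum_rankK => ->; rewrite mxE LE !enum_rankK.
  rewrite /A (negPf u0w0) (negPf nadj) !mul0r !mulr0 !subr0 add0r mulr0.
  apply/eqP; rewrite gt_eqF // (bigD1 z0) //= u0z0 w0z0.
  rewrite ltr_pwDl ?sumr_ge0 => // [|z _].
    by rewrite !mul1r mulr_gt0 // invr_gt0 mulr_gt0.
  by rewrite mulr_ge0 // divr_ge0 ?ler0n // ltW // mulr_gt0.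
have entry u w (i := enum_rank u) (j := enum_rank w) :
    ((L - theta1%:M) *m (L - theta2%:M)) i j = (t *: (wvec *m wvec^T)) i j <->
    \sum_z (e u z && e w z)%:R / deg z =
    t * deg u * deg w + (2 - theta1 - theta2) * (e u w)%:R
    - (theta1 - 1) * (theta2 - 1) * deg u * (u == w)%:R.
  rewrite shiftE sum_A !mxE big_ord1 !mxE !enum_rankK -!q_sqr.
  under [\sum_z _]eq_bigr do rewrite -q_sqr.
  set S := \sum_z _.
  have qq0 : q u * q w != 0 by rewrite mulf_neq0.
  rewrite -[X in _ <-> _ = _ - X]mulrA.
  (* The diagonal term also acquires the common factor [q u * q w], which then cancels
     throughout. *)
  have -> : q u ^+ 2 * (u == w)%:R = q u * q w * (u == w)%:R.
    by case: eqVneq => [->|]; rewrite ?mulr0.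
  have qu := q_neq0 u; have qw := q_neq0 w.
  split=> [E|->]; last by rewrite /A; field; rewrite qu qw.
  have {}E : S / (q u * q w) = t * (q u * q w)
      - ((1 - theta1) * (1 - theta2) * (u == w)%:R
         - (2 - theta1 - theta2) * A u w) by rewrite -E; ring.
  by rewrite -[S](divfK qq0) E /A; field; rewrite qu qw.
have threeP : three_distinct_L_eigenvalues e 0 theta1 theta2 <->
    (L - theta1%:M) *m (L - theta2%:M) = t *: (wvec *m wvec^T).
  rewrite /t -sum_wvec.
  apply: iff_trans (eigenvalues_in_three_roots theta1 theta2
    normalized_laplacian_tr wvec0 L_wvec ker_L).
  split=> [[_ E] a|]; first by rewrite -E.
  exact: (eigenvalues_exactly_three normalized_laplacian_tr).
split=> [/threeP E u w|E]; first by apply/entry; rewrite E.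
apply/threeP/matrixP => i j.
by rewrite -(enum_valK i) -(enum_valK j); apply/entry.
Qed.
End NormalizedLaplacian.

(** * Counts of points and blocks in a quasi-symmetric design *)

Section PointBlockGraph.
Variables (R : realType) (P B : finType) (inc : P -> B -> bool).
Variables (v k lam r x y : nat).
Hypotheses (des : is_2design inc v k lam) (rep : replication_number inc r).
Hypothesis qs : quasi_symmetric inc x y.

Let e := point_block_graph inc y.
Let a : R := bg_a R #|B| k r x y.
Let c : R := bg_c R #|B| k r lam x y.
Let d : R := bg_d R #|B| k r lam x y.

Let yx_neq0 : y%:R - x%:R != 0 :> R.
Proof. by case: qs => xy _ _ _; rewrite subr_eq0 eqr_nat eq_sym. Qed.

Let sum_inc_blocks p : \sum_bl (inc p bl)%:R = r%:R :> R.
Proof. by rewrite sum_bool_card -(rep p). Qed.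

Let sum_inc_points bl : \sum_p (inc p bl)%:R = k%:R :> R.
Proof. by case: des => _ _ _ /(_ bl) <- _; rewrite sum_bool_card. Qed.

Let sum_block_graph bl : \sum_bl' (block_graph inc y bl bl')%:R = a.
Proof.
have [na [nc [nd [[_ _ _ val _] Ea _ _]]]] :=
  block_graph_strongly_regular R des rep qs.
by rewrite sum_bool_card -[#|_|]/(valency (block_graph inc y) bl) val Ea.
Qed.

Let sum_neq_points p : \sum_(q : P) (p != q)%:R = v%:R - 1 :> R.
Proof.
case: des => _ _ <- _ _; transitivity (\sum_(q : P) (1 - (p == q)%:R * 1) : R).
  by apply: eq_bigr => q _; case: eqP => _ /=; ring.
by rewrite sumrB sum_delta sumr_const.
Qed.

Let sum_neq2_points (p p' : P) : p != p' ->
  \sum_(q : P) ((p != q) && (p' != q))%:R = v%:R - 2 :> R.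
Proof.
move=> pp'; case: des => _ _ <- _ _.
transitivity (\sum_(q : P) (1 - (p == q)%:R * 1 - (p' == q)%:R * 1) : R).
  apply: eq_bigr => q _; case: (eqVneq p q) pp' => [<-|_ _] /=.
    by rewrite eq_sym => /negPf -> /=; ring.
  by case: eqP => _ /=; ring.
by rewrite !sumrB !sum_delta sumr_const; ring.
Qed.

Let sum_neq_inc p bl :
  \sum_q ((p != q) && inc q bl)%:R = k%:R - (inc p bl)%:R :> R.
Proof.
rewrite -(sum_inc_points bl) -(sum_delta p (fun q => (inc q bl)%:R)) -sumrB.
by apply: eq_bigr => q _; case: eqP => _ /=; ring.
Qed.

Let sum_inc2_points bl bl' :
  \sum_p (inc p bl && inc p bl')%:R = (meet_size inc bl bl')%:R :> R.
Proof.
rewrite sum_bool_card /meet_size; congr (_%:R); apply: eq_card => p.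
by rewrite !inE.
Qed.

Let sum_inc2_blocks p p' : p != p' ->
  \sum_bl (inc p bl && inc p' bl)%:R = lam%:R :> R.
Proof.
case: des => _ _ _ _ lamE /lamE <-; rewrite sum_bool_card; congr (_%:R).
by apply: eq_card => bl; rewrite !inE.
Qed.

Let sum_common_blocks bl bl' : bl != bl' ->
  \sum_b (block_graph inc y bl b && block_graph inc y bl' b)%:R
    = if block_graph inc y bl bl' then c else d.
Proof.
have [na [nc [nd [[_ _ _ _ srg] _ Ec Ed]]]] :=
  block_graph_strongly_regular R des rep qs.
move=> /srg; rewrite /common_neighbors sum_bool_card => ->.
by rewrite /c /d -Ec -Ed; case: ifP.
Qed.

(** Entrywise form of [N^T N = (k - x) I + x J + (y - x) A], where [N] is the incidence matrix, [J]
    the all-ones matrix and [A] the adjacency matrix of the block graph. *)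
Let meet_sizeE bl bl' : (meet_size inc bl bl')%:R =
  (k%:R - x%:R) * (bl == bl')%:R + x%:R
  + (y%:R - x%:R) * (block_graph inc y bl bl')%:R :> R.
Proof.
rewrite /block_graph; case: eqVneq => [<-|nbl] /=.
  by rewrite /meet_size setIid; case: des => _ _ _ -> _; ring.
case: qs => xy /(_ _ _ nbl)[] -> _ _; last by rewrite eqxx /=; ring.
by rewrite (negPf xy) /=; ring.
Qed.

(* Double counting of the pairs (q, bl') with q on bl and p, q on bl'. *)
Let sum_inc_block_graph p bl :
  \sum_bl' (inc p bl' && block_graph inc y bl bl')%:R =
  (if inc p bl then (lam%:R - 1) * (k%:R - 1) - (x%:R - 1) * (r%:R - 1)
   else lam%:R * k%:R - x%:R * r%:R) / (y%:R - x%:R) :> R.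
Proof.
set n := \sum_bl' _.
have : \sum_bl' (inc p bl')%:R * (meet_size inc bl bl')%:R =
    (k%:R - x%:R) * (inc p bl)%:R + x%:R * r%:R + (y%:R - x%:R) * n :> R.
  rewrite -(sum_delta bl (fun bl' => (inc p bl')%:R)) -(sum_inc_blocks p).
  rewrite /n !mulr_sumr -!big_split; apply: eq_bigr => bl' _ /=.
  by rewrite meet_sizeE -mulnb natrM; ring.
have -> : \sum_bl' (inc p bl')%:R * (meet_size inc bl bl')%:R =
    (r%:R - lam%:R) * (inc p bl)%:R + lam%:R * k%:R :> R.
  under eq_bigr do rewrite -sum_inc2_points mulr_sumr.
  rewrite exchange_big /= -(sum_delta p (fun q => (inc q bl)%:R)).
  rewrite -(sum_inc_points bl) !mulr_sumr -big_split; apply: eq_bigr => q _ /=.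
  transitivity ((inc q bl)%:R * \sum_bl' (inc p bl' && inc q bl')%:R : R).
    by rewrite mulr_sumr; apply: eq_bigr => bl' _; rewrite -!mulnb !natrM; ring.
  case: (eqVneq p q) => [<-|/sum_inc2_blocks ->] /=; last by ring.
  by under eq_bigr do rewrite andbb; rewrite sum_inc_blocks; ring.
move=> E; apply: (mulIf yx_neq0); rewrite divfK //.
by case: (inc p bl) E => /= E; lra.
Qed.

(** * Valencies and connectedness of the graph on points and blocks *)

Let vP : R := v%:R - 1 + r%:R.
Let vB : R := k%:R + a.

Let valencyE u : (valency e u)%:R = (if u is inl _ then vP else vB).
Proof.
rewrite -sum_bool_card big_sumType /=; case: u => [p|bl].
  by rewrite sum_neq_points sum_inc_blocks.
by rewrite sum_inc_points sum_block_graph.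
Qed.

(** Valencies are constant on points and on blocks, so each entry of [A D^-1 A] is a sum of two
    fractions, the left-hand sides of the seven equations. *)
Let common_neighborsE u w :
  \sum_z (e u z && e w z)%:R / (valency e z)%:R =
  (\sum_q (e u (inl q) && e w (inl q))%:R) / vP
  + (\sum_bl (e u (inr bl) && e w (inr bl))%:R) / vB.
Proof.
rewrite big_sumType /= !mulr_suml.
by congr (_ + _); apply: eq_bigr => z _; rewrite valencyE.
Qed.
Let sum_valency : \sum_u (valency e u)%:R = v%:R * vP + #|B|%:R * vB.
Proof.
rewrite (eq_bigr _ (fun u _ => valencyE u)) big_sumType /= !sumr_const.
by case: des => _ _ -> _ _; rewrite -[vP *+ _]mulr_natl -[vB *+ _]mulr_natl.
Qed.

Let block_point bl : exists p, inc p bl.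
Proof.
case: des => /andP[k_gt1 _] _ _ /(_ bl) kE _.
have /card_gt0P[p] : (0 < #|block_points inc bl|)%N by rewrite kE ltnW.
by rewrite inE; exists p.
Qed.

Let block_nonpoint bl : exists p, ~~ inc p bl.
Proof.
case: des => /andP[_ kv] _ Pv /(_ bl) kE _.
have /card_gt0P[p] : (0 < #|~: block_points inc bl|)%N.
  by rewrite cardsCs setCK kE Pv subn_gt0.
by rewrite !inE; exists p.
Qed.

Let valency_gt0 u : (0 < valency e u)%N.
Proof.
apply/card_gt0P; case: u => [p|bl]; last first.
  by have [p pbl] := block_point bl; exists (inl p); rewrite inE.
case: des => /andP[k_gt1 kv] _ Pv _ _.
have /card_gt0P[q] : (0 < #|[set~ p]|)%N by rewrite cardsC1 Pv; lia.
by rewrite !inE => qp; exists (inl q); rewrite inE /= eq_sym.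
Qed.

Let connect_points p q : connect e (inl p) (inl q).
Proof. by case: (eqVneq p q) => [->|pq]; [|apply: connect1]. Qed.

(** Points form a clique, and every block is adjacent to a point. *)
Let connected u w : connect e u w.
Proof.
have to_point z : exists p, connect e z (inl p).
  case: z => [p|bl]; first by exists p.
  by have [p pbl] := block_point bl; exists p; apply: connect1.
have sym_e := sym_connect_sym (point_block_graph_simple inc y).1.
have [p up] := to_point u; have [q wq] := to_point w.
apply: connect_trans up (connect_trans (connect_points p q) _).
by rewrite sym_e.
Qed.

(** * The seven equations *)

(** Both sides of the matrix identity depend only on the kind of the pair of vertices. All seven
    kinds occur: [1 < k < v] gives incident and non-incident pairs, and both intersection sizes are
    attained. *)
Lemma point_block_graph_three_L_eigenvalues (theta1 theta2 : R)
    (t := theta1 * theta2 / (v%:R * vP + #|B|%:R * vB)) :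
  three_distinct_L_eigenvalues e 0 theta1 theta2 <->
  (v%:R - 1) / vP + r%:R / vB
    = t * vP ^+ 2 - (theta1 - 1) * (theta2 - 1) * vP /\
  (v%:R - 2) / vP + lam%:R / vB = t * vP ^+ 2 + 2 - theta1 - theta2 /\
  k%:R / vP + a / vB = t * vB ^+ 2 - (theta1 - 1) * (theta2 - 1) * vB /\
  x%:R / vP + d / vB = t * vB ^+ 2 /\
  y%:R / vP + c / vB = t * vB ^+ 2 + 2 - theta1 - theta2 /\
  k%:R / vP + (lam%:R * k%:R - x%:R * r%:R) / ((y%:R - x%:R) * vB)
    = t * vP * vB /\
  (k%:R - 1) / vP
      + ((lam%:R - 1) * (k%:R - 1) - (x%:R - 1) * (r%:R - 1))
        / ((y%:R - x%:R) * vB)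
    = t * vP * vB + 2 - theta1 - theta2.
Proof.
have [xy meetP [bl1 [bl2 [bl12 meet12]]] [bl3 [bl4 [bl34 meet34]]]] := qs.
have [q1 q1bl1] := block_point bl1; have [p1 p1bl1] := block_nonpoint bl1.
have p1q1 : p1 != q1 by apply: contraNneq p1bl1 => ->.
(* [q1] lies on [bl1] and [p1] does not, so the path runs from [p1] through [q1] to [bl1]. *)
have path3 : exists u w z, [/\ u != w, ~~ e u w, e u z & e w z].
  by exists (inl p1), (inr bl1), (inl q1); split.
apply: iff_trans (three_distinct_L_eigenvaluesP (R := R)
  (point_block_graph_simple inc y) valency_gt0 connected theta1 theta2 path3) _.
rewrite sum_valency -/t.
(* The common neighbors among points are the points of [bl] other than [p], whence [k] or [k - 1] in
   the numerator. *)
have incE p bl : \sum_z (e (inl p) z && e (inr bl) z)%:R / (valency e z)%:R =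
    (k%:R - (inc p bl)%:R) / vP +
    (if inc p bl then (lam%:R - 1) * (k%:R - 1) - (x%:R - 1) * (r%:R - 1)
     else lam%:R * k%:R - x%:R * r%:R) / ((y%:R - x%:R) * vB).
  by rewrite common_neighborsE /= sum_neq_inc sum_inc_block_graph invfM mulrA.
split=> [E|[E1 [E2 [E3 [E4 [E5 [E6 E7]]]]]]].
  have adj34 : block_graph inc y bl3 bl4 by rewrite /block_graph bl34 meet34 /=.
  have nadj12 : block_graph inc y bl1 bl2 = false.
    by rewrite /block_graph meet12 (negPf xy) andbF.
  (* The pairs used, in order: equal points, distinct points, equal blocks, blocks meeting in [x]
     points, blocks meeting in [y] points, a non-incident pair, an incident pair. *)
  split; last split; last split; last split; last split; last split.
  - move: (E (inl p1) (inl p1)); rewrite common_neighborsE /= !valencyE /= eqxx.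
    under eq_bigr do rewrite andbb; rewrite sum_neq_points.
    under eq_bigr do rewrite andbb; rewrite sum_inc_blocks => ->.
    by rewrite eqxx /=; ring.
  - move: (E (inl p1) (inl q1)); rewrite common_neighborsE /= !valencyE /=.
    rewrite sum_neq2_points // sum_inc2_blocks // => ->.
    by rewrite (inj_eq inl_inj) p1q1 (negPf p1q1) /=; ring.
  - move: (E (inr bl1) (inr bl1)); rewrite common_neighborsE /= !valencyE /=.
    under eq_bigr do rewrite andbb; rewrite sum_inc_points.
    under eq_bigr do rewrite andbb; rewrite sum_block_graph => ->.
    by rewrite eqxx (block_graph_simple inc y).2 /=; ring.
  - move: (E (inr bl1) (inr bl2)); rewrite common_neighborsE /= !valencyE /=.
    rewrite sum_inc2_points sum_common_blocks // meet12 nadj12 => ->.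
    by rewrite (inj_eq inr_inj) (negPf bl12) /=; ring.
  - move: (E (inr bl3) (inr bl4)); rewrite common_neighborsE /= !valencyE /=.
    rewrite sum_inc2_points sum_common_blocks // meet34 adj34 => ->.
    by rewrite (inj_eq inr_inj) (negPf bl34) /=; ring.
  - move: (E (inl p1) (inr bl1)); rewrite incE !valencyE /= (negPf p1bl1) subr0.
    by move=> ->; rewrite /=; ring.
  - move: (E (inl q1) (inr bl1)); rewrite incE !valencyE /= q1bl1.
    by move=> ->; rewrite /=; ring.
have eqPB p bl : \sum_z (e (inl p) z && e (inr bl) z)%:R / (valency e z)%:R =
    t * vP * vB + (2 - theta1 - theta2) * (inc p bl)%:R.
  rewrite incE; case: (inc p bl) => /=; first by rewrite E7; ring.
  by rewrite subr0 E6; ring.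
move=> [p|bl] [q|bl']; rewrite !valencyE.
- rewrite common_neighborsE /= (inj_eq inl_inj); case: eqVneq => [<-|pq] /=.
    under eq_bigr do rewrite andbb; rewrite sum_neq_points.
    under eq_bigr do rewrite andbb; rewrite sum_inc_blocks E1.
    by ring.
  by rewrite sum_neq2_points // sum_inc2_blocks // E2; ring.
- by rewrite eqPB /=; ring.
(* By symmetry a block-point pair reduces to the point-block case. *)
- under eq_bigr do rewrite andbC.
  by rewrite eqPB /=; ring.
rewrite common_neighborsE /= (inj_eq inr_inj); case: eqVneq => [<-|nbl] /=.
  under eq_bigr do rewrite andbb; rewrite sum_inc_points.
  under eq_bigr do rewrite andbb; rewrite sum_block_graph E3.
  by rewrite (block_graph_simple inc y).2 /=; ring.
rewrite sum_inc2_points sum_common_blocks //.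
case: ifP => adj; first by move: adj => /andP[_ /eqP->]; rewrite E5 /=; ring.
(* Distinct non-adjacent blocks meet in [x] points, since meeting in [y] points would make them
   adjacent. *)
case: (meetP _ _ nbl) => [->|m]; first by rewrite E4 /=; ring.
by move: adj; rewrite /block_graph nbl m eqxx.
Qed.

End PointBlockGraph.

Theorem proposition5 (R : realType) (P B : finType) (inc : P -> B -> bool)
    (v k lam r b x y : nat) (theta1 theta2 : R)
    (hdesign : is_2design inc v k lam)
    (hr : replication_number inc r)
    (hb : #|B| = b)
    (hqs : quasi_symmetric inc x y)
    (hbireg : biregular (point_block_graph inc y))
    (hpart : valency_partition (point_block_graph inc y) =
             [set point_vertices P B; block_vertices P B]) :
  let a : R := bg_a R b k r x y in
  let c : R := bg_c R b k r lam x y in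
  let d : R := bg_d R b k r lam x y in
  let t : R := theta1 * theta2 /
    (v%:R * (v%:R - 1 + r%:R) + b%:R * (k%:R + a)) in
  three_distinct_L_eigenvalues (point_block_graph inc y) 0 theta1 theta2
  <->
  (v%:R - 1) / (v%:R - 1 + r%:R) + r%:R / (k%:R + a)
    = t * (v%:R - 1 + r%:R) ^+ 2
      - (theta1 - 1) * (theta2 - 1) * (v%:R - 1 + r%:R) /\
  (v%:R - 2) / (v%:R - 1 + r%:R) + lam%:R / (k%:R + a)
    = t * (v%:R - 1 + r%:R) ^+ 2 + 2 - theta1 - theta2 /\
  k%:R / (v%:R - 1 + r%:R) + a / (k%:R + a)
    = t * (k%:R + a) ^+ 2 - (theta1 - 1) * (theta2 - 1) * (k%:R + a) /\
  x%:R / (v%:R - 1 + r%:R) + d / (k%:R + a) = t * (k%:R + a) ^+ 2 /\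
  y%:R / (v%:R - 1 + r%:R) + c / (k%:R + a)
    = t * (k%:R + a) ^+ 2 + 2 - theta1 - theta2 /\
  k%:R / (v%:R - 1 + r%:R)
      + (lam%:R * k%:R - x%:R * r%:R) / ((y%:R - x%:R) * (k%:R + a))
    = t * (v%:R - 1 + r%:R) * (k%:R + a) /\
  (k%:R - 1) / (v%:R - 1 + r%:R)
      + ((lam%:R - 1) * (k%:R - 1) - (x%:R - 1) * (r%:R - 1))
        / ((y%:R - x%:R) * (k%:R + a))
    = t * (v%:R - 1 + r%:R) * (k%:R + a) + 2 - theta1 - theta2.
Proof.
move: hb => <-; exact: point_block_graph_three_L_eigenvalues.
Qed.
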